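(* Every bipartite permutation graph is Parikh word representable.
   Context: Let $\Sigma=\{a_1<a_2<\dots<a_s\}$ be a finite ordered alphabet and $w=w_1w_2\cdots w_n$ a nonempty word over $\Sigma$ with each $w_i\in\Sigma$. The Parikh graph $\mathcal{G}(w)$ of $w$ over $\Sigma$ is the simple undirected graph with vertex set $\{1,\dots,n\}$ in which, for $1\le i<j\le n$, the vertices $i$ and $j$ are adjacent if and only if $w_i=a_k$ and $w_j=a_{k+1}$ for some $1\le k\le s-1$. A graph $G$ is Parikh word representable if $G$ is isomorphic to $\mathcal{G}(w)$ for some nonempty word $w$ over some finite ordered alphabet. A graph $G=(V,E)$ (finite, simple) is a permutation graph if there is an ordering $v_1,\dots,v_n$ of $V$ and a permutation $\tau$ of $\{1,\dots,n\}$ such that for all $1\le i<j\le n$, $(v_i,v_j)\in E$ if and only if $\tau(i)>\tau(j)$. A bipartite permutation graph is a graph that is both bipartite and a permutation graph. *)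

(* Defs.v *)
From mathcomp Require Import all_boot all_fingroup.

Set Implicit Arguments.
Unset Strict Implicit.
Unset Printing Implicit Defensive.

Record sgraph := SGraph {
  vertex :> finType;
  adj : rel vertex;
  adj_sym : symmetric adj;
  adj_irrefl : irreflexive adj
}.

Definition graph_iso (G H : sgraph) : Prop :=
  exists2 f : G -> H, bijective f & forall x y, adj (f x) (f y) = adj x y.

Definition bipartite (G : sgraph) : Prop :=
  exists A : {set G}, forall x y : G, adj x y -> (x \in A) != (y \in A).

Definition permutation_graph (G : sgraph) : Prop :=
  exists (v : 'I_#|G| -> G) (tau : 'S_#|G|),
    bijective v /\
    forall i j : 'I_#|G|, i < j -> adj (v i) (v j) = (tau j < tau i).

(* The ordered alphabet a_1 < ... < a_s is 'I_s, with a_(k+1) encoded by k,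
   and the positions of a word w are the elements of 'I_(size w). *)
Section ParikhGraph.

Variables (s : nat) (w : seq 'I_s).

Definition parikh_lt (i j : 'I_(size w)) : bool :=
  (i < j) && (tnth (in_tuple w) j == (tnth (in_tuple w) i).+1 :> nat).

Definition parikh_adj : rel 'I_(size w) :=
  [rel i j | parikh_lt i j || parikh_lt j i].

Lemma parikh_adj_sym : symmetric parikh_adj.
Proof. by move=> i j; exact: orbC. Qed.

Lemma parikh_adj_irrefl : irreflexive parikh_adj.
Proof. by move=> i; rewrite /parikh_adj /= /parikh_lt ltnn. Qed.

Definition parikh_graph : sgraph := SGraph parikh_adj_sym parikh_adj_irrefl.

End ParikhGraph.

Definition parikh_word_representable (G : sgraph) : Prop :=
  exists (s : nat) (w : seq 'I_s), w <> [::] /\ graph_iso G (parikh_graph w).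

(* Main.v *)
Require Import Defs.
From mathcomp Require Import all_boot all_fingroup.
From mathcomp Require Import zify.

Set Implicit Arguments.
Unset Strict Implicit.
Unset Printing Implicit Defensive.

(** A permutation graph is the incomparability graph of a poset [lt], the
    intersection of two linear orders. Fix a 2-colouring and let the level of
    [x] be the length of the longest colour-alternating [lt]-chain that starts
    in the colour class [A] and ends at [x], or 0 if there is none.
    Levels are nondecreasing along [lt], and the levels of adjacent vertices differ by exactly 1. Using levels as
    letters, it remains to order the vertices so that, for [x] and [y] in
    consecutive levels [k] and [k+1], [x] comes before [y] if they are adjacent
    and after [y] otherwise, i.e. when [lt x y]. On two consecutive levels these
    constraints, together with reversed [lt] inside a level, form a linear order,
    and linear orders on levels 0,1, on levels 1,2, and so on, which agree on the
    common levels, have a common linear extension. *)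

(** Recursion along [lt]: iterating the right-hand side [n] times settles all values at rank below
    [n]. *)
Lemma bigmax_rec_exists (T : finType) (lt : rel T) (rk : T -> nat)
    (b : T -> nat) (c : T -> T -> nat) :
  (forall x y, lt x y -> rk x < rk y) ->
  exists l : T -> nat,
    forall x, l x = maxn (b x) (\max_(y | lt y x) (l y + c y x)).
Proof.
move=> lt_rk.
pose F (l : T -> nat) x := maxn (b x) (\max_(y | lt y x) (l y + c y x)).
suff [l lP] : exists l, forall x, rk x < (\max_y rk y).+1 -> l x = F l x.
  by exists l => x; apply: lP; rewrite ltnS (leq_bigmax x).
elim: (_.+1) => [|n [l lP]]; first by exists (fun=> 0).
exists (F l) => x rkx; congr maxn; apply: eq_bigr => y /lt_rk yx.
by rewrite lP // (leq_trans yx).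
Qed.

(** Remove a source, sort the rest, and put the source in front; [R] need not be transitive. *)
Lemma topological_sort (T : finType) (R : rel T) :
  (forall S : {set T}, S != set0 ->
    exists2 x, x \in S & forall y, y \in S -> ~~ R y x) ->
  exists s : seq T, [/\ uniq s, forall x, x \in s &
    forall x y, R x y -> index x s <= index y s].
Proof.
move=> source.
suff sortS n : forall S : {set T}, #|S| = n -> exists s : seq T,
    [/\ uniq s, s =i S & forall x y, x \in S -> y \in S -> R x y ->
      index x s <= index y s].
  have [s [s_uniq sE sR]] := sortS _ [set: T] erefl.
  by exists s; split=> [|x|x y] //; [rewrite sE inE | apply: sR; rewrite inE].
elim: n => [|n IHn] S cardS.
  have S0 := cards0_eq cardS.
  by exists [::]; split=> [|x|x y] //; rewrite S0 inE.
have [|x xS xmin] := source S; first by rewrite -card_gt0 cardS.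
have [|s [s_uniq sE sR]] := IHn (S :\ x).
  by have := cardsD1 x S; rewrite xS cardS => -[].
exists (x :: s); split.
- by rewrite /= sE !inE eqxx.
- by move=> y; rewrite inE sE !inE; case: eqVneq => // ->.
move=> y z yS zS Ryz /=; case: eqVneq => // neq_xy.
case: eqVneq Ryz => [<-|neq_xz] Ryz; first by rewrite (negPf (xmin y yS)) in Ryz.
by rewrite ltnS sR // !inE eq_sym ?neq_xy ?neq_xz.
Qed.

(** The word spells the levels along [s], and [x] goes to position [index x s]. *)
Lemma parikh_word_representable_of_seq (G : sgraph) (l : G -> nat) (s : seq G) :
  0 < #|G| -> uniq s -> (forall x, x \in s) ->
  (forall x y, adj x y = (index x s < index y s) && (l y == (l x).+1) ||
                         (index y s < index x s) && (l x == (l y).+1)) ->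
  parikh_word_representable G.
Proof.
move=> /card_gt0P[x0 _] s_uniq s_all adjE.
pose N := \max_x l x; pose w := [seq (inord (l x) : 'I_N.+1) | x <- s].
have f_proof x : index x s < size w by rewrite size_map index_mem.
pose f x : parikh_graph w := Ordinal (f_proof x).
have f_letter x : tnth (in_tuple w) (f x) = l x :> nat.
  rewrite (tnth_nth ord0) (nth_map x) ?index_mem // nth_index //.
  by rewrite inordK // ltnS (leq_bigmax x).
exists N.+1, w; split; first by have := s_all x0; rewrite /w; case: (s).
exists f; last by move=> x y; rewrite [LHS]/(_ || _) /parikh_lt !f_letter adjE.
apply: inj_card_bij => [x y /(congr1 val) /= eq_xy|].
  by rewrite -(nth_index x0 (s_all x)) eq_xy nth_index.
rewrite card_ord size_map -(card_uniqP s_uniq).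
by apply/subset_leq_card/subsetP.
Qed.

Section IncomparabilityGraph.

Variables (G : sgraph) (lt : rel G) (rk : G -> nat).
Hypothesis lt_trans : transitive lt.
Hypothesis lt_rk : forall x y, lt x y -> rk x < rk y.
Hypothesis adjE : forall x y, adj x y = [&& x != y, ~~ lt x y & ~~ lt y x].

Lemma lt_adjF x y : lt x y -> adj x y = false.
Proof. by move=> xy; rewrite adjE xy andbF. Qed.

Lemma comparable_of_nadj x y : ~~ adj x y -> [\/ x = y, lt x y | lt y x].
Proof.
rewrite adjE; case: eqVneq => [->|_] /=; first by constructor 1.
by case: (boolP (lt x y)) => [?|_ /negbNE ?]; [constructor 2 | constructor 3].
Qed.

(** The parity of a level is the colour, so for adjacent vertices it suffices to bound the
    difference of levels by 1. *)
Lemma levels_exist : bipartite G ->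
  exists l : G -> nat,
    (forall x y, lt x y -> l x <= l y) /\
    (forall x y, adj x y -> l y = (l x).+1 \/ l x = (l y).+1).
Proof.
move=> [A bipA]; pose c (x y : G) : nat := (x \in A) != (y \in A).
have [l lE] := bigmax_rec_exists (fun x => x \in A : nat) c lt_rk.
have lt_l x y : lt x y -> l x + c x y <= l y.
  by move=> xy; rewrite (lE y) leq_max orbC (bigmax_sup x).
have l_cases x : l x = (x \in A) \/ exists2 y, lt y x & l x = l y + c y x.
  have [y yx|no_lt] := pickP (fun y => lt y x); last first.
    by left; rewrite lE big_pred0 // maxn0.
  rewrite lE; case: leqP => _; [right | by left].
  rewrite (bigmax_eq_arg y) //.
  by case: arg_maxnP => // z zx _; exists z.
have odd_l x : odd (l x) = (x \in A).
  have [n] := ubnP (rk x); elim: n x => // n IHn x rkx.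
  case: (l_cases x) => [->|[y yx ->]]; first by case: (x \in A).
  rewrite oddD IHn ?/c; last by have := lt_rk yx; lia.
  by case: (x \in A) (y \in A) => [] [].
have l_adj x y : adj x y -> l y <= (l x).+1.
  have [n] := ubnP (rk y); elim: n y => // n IHn y rky xy.
  case: (l_cases y) => [->|[z zy ->]]; first by case: (y \in A).
  have xz_nlt : ~~ lt x z.
    by apply: contraL xy => xz; rewrite (lt_adjF (lt_trans xz zy)).
  have [zx|nzx] := boolP (lt z x).
    have := lt_l _ _ zx; have := bipA _ _ xy; rewrite /c.
    by case: (x \in A) (y \in A) (z \in A) => [] [] []; lia.
  have [eq_xz|neq_xz] := eqVneq x z; first by rewrite eq_xz /c; case: eqP; lia.
  (* Now [y] and [z] both have the colour opposite to [x], so [c z y = 0] and [y] inherits the bound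
     for [z]. *)
  have xz : adj x z by rewrite adjE neq_xz xz_nlt.
  have := IHn z _ xz; have := lt_rk zy; rewrite /c.
  have := bipA _ _ xy; have := bipA _ _ xz.
  by case: (x \in A) (y \in A) (z \in A) => [] [] []; lia.
exists l; split=> [x y /lt_l|x y xy]; first by lia.
have := l_adj _ _ xy; have := l_adj y x; rewrite adj_sym => /(_ xy).
by have := bipA _ _ xy; rewrite -!odd_l; lia.
Qed.

Variable l : G -> nat.
Hypothesis l_mono : forall x y, lt x y -> l x <= l y.
Hypothesis l_adj : forall x y, adj x y -> l y = (l x).+1 \/ l x = (l y).+1.

Definition precedes : rel G :=
  [rel x y | lt y x && (l x <= (l y).+1) || adj x y && (l y == (l x).+1)].

(** Adjacent vertices have different levels, so each level is a chain. *)
Lemma same_level_lt x y : l x = l y -> rk x <= rk y -> x = y \/ lt x y.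
Proof.
move=> lxy rkxy; have [|->|?|/lt_rk] := @comparable_of_nadj x y; [|by left|by right|lia].
by apply/negP => /l_adj; lia.
Qed.

(* Climb the levels: let [x] be the first vertex of [S] in its level. If [x] has
   a predecessor in [S] one level above, move to the first vertex of [S] in that
   level: it has no predecessor in [S] one level below, since [precedes] is
   transitive on two consecutive levels. *)
Lemma precedes_source (S : {set G}) : S != set0 ->
  exists2 x, x \in S & forall y, y \in S -> ~~ precedes y x.
Proof.
(* As [precedes] reverses [lt] inside a level, the first vertex is the one of largest [rk]. *)
have level_top x0 : x0 \in S -> exists2 x, (x \in S) && (l x == l x0) &
    forall y, y \in S -> l y = l x0 -> rk y <= rk x.
  move=> x0S.
  case: (@arg_maxnP _ x0 (fun x => (x \in S) && (l x == l x0)) rk).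
    by rewrite x0S eqxx.
  by move=> x xS xmax; exists x => // y yS ly; apply: xmax; rewrite /= yS ly eqxx.
have climb n : forall x, x \in S -> \max_y l y - l x < n ->
    (forall y, y \in S -> l y = l x -> rk y <= rk x) ->
    (forall y, y \in S -> precedes y x -> l x <= l y) ->
    exists2 x, x \in S & forall y, y \in S -> ~~ precedes y x.
  elim: n => // n IHn x xS nx xtop xlow.
  have [y0 /andP[y0S y0x]|no_pred] := pickP (fun y => (y \in S) && precedes y x).
    have [y0_lx xy0] : l y0 = (l x).+1 /\ lt x y0.
      case/orP: (y0x) => [/andP[xy0 ly0]|/andP[_ /eqP ly0]]; last first.
        by have := xlow _ y0S y0x; lia.
      split=> //; have := l_mono xy0; have := lt_rk xy0; have := xtop _ y0S.
      by lia.
    have [y /andP[yS /eqP ly] ytop] := level_top _ y0S.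
    have xy : lt x y.
      have [||<- //|] := @same_level_lt y0 y; [by rewrite ly | exact: ytop|].
      exact: lt_trans.
    apply: (IHn y) => //.
    - have := leq_bigmax (F := l) y; lia.
    - by move=> z zS lz; apply: ytop => //; rewrite lz.
    move=> z zS /orP[/andP[/l_mono //]|/andP[zy /eqP lyz]].
    (* Here [z] lies on the level of [x], so [z] is [x] or below it, hence below [y] and not
       adjacent to [y]. *)
    have [||zx|zx] := @same_level_lt z x; [lia | by apply: xtop => //; lia| |].
      by rewrite zx (lt_adjF xy) in zy.
    by rewrite (lt_adjF (lt_trans zx xy)) in zy.
  by exists x => // y yS; have := no_pred y; rewrite /= yS /= => ->.
case/set0Pn=> x0 x0S.
case: (@arg_minnP _ x0 (mem S) l x0S) => x1 x1S lmin.
have [x /andP[xS /eqP lx] xtop] := level_top _ x1S.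
apply: (climb (\max_y l y - l x).+1 x) => //.
  by move=> y yS ly; apply: xtop => //; rewrite ly.
by move=> y yS _; rewrite lx; apply: lmin.
Qed.

Lemma representable_of_levels : 0 < #|G| -> parikh_word_representable G.
Proof.
move=> G_gt0.
have [s [s_uniq s_all sR]] := topological_sort precedes_source.
have idx_neq x y : l y = (l x).+1 -> index x s != index y s.
  move=> lyx; apply/eqP => eq_xy; have := nth_index x (s_all x).
  by rewrite eq_xy nth_index // => yx; move: lyx; rewrite yx; lia.
have up x y : l y = (l x).+1 -> (index x s < index y s) = adj x y.
  move=> lyx; have neq_xy := idx_neq _ _ lyx; apply/idP/idP => [|xy]; last first.
    by have := sR x y; rewrite /precedes /= xy lyx eqxx orbT => /(_ isT); lia.
  apply: contraTT => /comparable_of_nadj[eq_xy|xy|/l_mono]; [|..|lia].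
    by move: lyx; rewrite eq_xy; lia.
  by have := sR y x; rewrite /precedes /= xy lyx leqnn -leqNgt => /(_ isT).
apply: (@parikh_word_representable_of_seq G l s) => // x y.
have [lyx|nlyx] := eqVneq (l y) (l x).+1.
  by rewrite andbT up // (_ : l x == _ = false) ?andbF ?orbF //; lia.
have [lxy|nlxy] := eqVneq (l x) (l y).+1; first by rewrite andbF andbT up // adj_sym.
by rewrite !andbF; apply/negP => /l_adj; lia.
Qed.

End IncomparabilityGraph.

Theorem theorem4p7 (G : sgraph) (G_nonempty : 0 < #|G|)
    (G_bip : bipartite G) (G_perm : permutation_graph G) :
  parikh_word_representable G.
Proof.
have [v [tau [[p vK pK] adj_v]]] := G_perm.
(* The inverse [p] of [v] gives positions and serves as the rank; distinct vertices are incomparable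
   exactly when [tau] inverts their positions. *)
pose lt : rel G := [rel x y | (p x < p y) && (tau (p x) < tau (p y))].
have lt_trans : transitive lt.
  by move=> y x z /= /andP[? ?] /andP[? ?]; apply/andP; split; lia.
have lt_rk x y : lt x y -> p x < p y by case/andP.
have adj_lt x y : p x < p y -> adj x y = ~~ lt x y.
  move=> xy; rewrite -{1}(pK x) -{1}(pK y) adj_v // /lt /= xy /= -leqNgt ltn_neqAle.
  by rewrite (inj_eq val_inj) (inj_eq perm_inj) andb_idl // neq_ltn xy orbT.
have adjE x y : adj x y = [&& x != y, ~~ lt x y & ~~ lt y x].
  have [->|neq_xy] := eqVneq x y; first exact: adj_irrefl.
  have: p x != p y :> nat by rewrite (inj_eq val_inj) (can_eq pK).
  rewrite neq_ltn => /orP[xy|yx].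
    by rewrite adj_lt // /lt /= [p y < p x]ltnNge (ltnW xy) /= andbT.
  by rewrite adj_sym adj_lt // /lt /= [p x < p y]ltnNge (ltnW yx).
have [l [l_mono l_adj]] := levels_exist lt_trans lt_rk adjE G_bip.
exact: (representable_of_levels lt_trans lt_rk adjE l_mono l_adj).
Qed.
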